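(* Let $(d(n))_{n=1}^\infty$ be a sequence of positive integers tending to infinity, let $(\Omega,\mathcal{F},P)$ be a probability space, and let $X\colon\Omega\to\mathbb{R}$ be an $\mathcal{F}$-measurable function. Let $\alpha=(\alpha^{(n)}_1,\ldots,\alpha^{(n)}_{d(n)})_{n=1}^\infty$ be a sequence of collections of real numbers that is asymptotically distributed as $(X,P)$. Suppose that the essential range $\mathcal{R}(X)$ is connected and bounded and that, for each $n\in\mathbb{N}$, the numbers $\alpha^{(n)}_1,\ldots,\alpha^{(n)}_{d(n)}$ belong to $\mathcal{R}(X)$ and are ordered in the ascending manner: $$\alpha^{(n)}_1\le\alpha^{(n)}_2\le\dots\le\alpha^{(n)}_{d(n)}.$$ Then $$\lim_{n\to\infty}\ \max_{1\le j\le d(n)}\ \sup_{\frac{j-1}{d(n)}\le u\le\frac{j}{d(n)}}|\alpha^{(n)}_j-Q_X(u)|=0.$$ In particular, $$\lim_{n\to\infty}\ \max_{1\le j\le d(n)}|\alpha^{(n)}_j-Q_X(j/d(n))|=0.$$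
   Context: The sequence $\alpha$ is said to be asymptotically distributed as $(X,P)$ if, for every continuous compactly supported function $\varphi$ on $\mathbb{R}$, $$\lim_{n\to\infty}\frac{1}{d(n)}\sum_{j=1}^{d(n)}\varphi(\alpha^{(n)}_j)=\int_\Omega\varphi\circ X\,dP.$$ The essential range, cumulative distribution function and quantile function of $X$ are $$\mathcal{R}(X):=\{v\in\mathbb{R}\colon P(X^{-1}(v-\varepsilon,v+\varepsilon))>0\ \ \forall\varepsilon>0\},$$ $$F_X(v):=P(X^{-1}(-\infty,v])\ (v\in\mathbb{R}),\qquad Q_X(p):=\inf\{v\in\mathbb{R}\colon F_X(v)\ge p\}\ (p\in(0,1)).$$ When $\mathcal{R}(X)$ is bounded, $Q_X$ has finite limits at $0$ and $1$ and is extended to $[0,1]$ by $Q_X(0):=\lim_{p\to0^+}Q_X(p)$ and $Q_X(1):=\lim_{p\to1^-}Q_X(p)$. *)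

(* Defs.v *)
From HB Require Import structures.
From mathcomp Require Import all_boot all_order all_algebra.
From mathcomp Require Import all_classical all_reals all_analysis.
Import Order.TTheory GRing.Theory Num.Theory.
Import numFieldNormedType.Exports.

Set Implicit Arguments.
Unset Strict Implicit.
Unset Printing Implicit Defensive.

Local Open Scope classical_set_scope.
Local Open Scope ring_scope.

Definition compactly_supported (R : realType) (phi : R -> R) : Prop :=
  compact (closure [set x | phi x != 0]).

(* [alpha n] is a [d n]-tuple of reals whose entries are numbered from 0. *)
Definition asymptotically_distributed (R : realType) (disp : measure_display)
    (Omega : measurableType disp) (P : probability Omega R) (X : {RV P >-> R})
    (d : nat -> nat) (alpha : forall n, 'I_(d n) -> R) : Prop :=
  forall phi : R -> R, continuous phi -> compactly_supported phi ->
    (d n)%:R^-1 * (\sum_(j < d n) phi (alpha n j)) @[n --> \oo]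
      --> \int[P]_w phi (X w).

Definition essential_range (R : realType) (disp : measure_display)
    (Omega : measurableType disp) (P : probability Omega R) (X : {RV P >-> R})
    : set R :=
  [set v | forall eps : R, 0 < eps ->
             (0 < P (X @^-1` `](v - eps)%R, (v + eps)%R[))%E].

(* The set below is nonempty and bounded below when 0 < p < 1; for other p the
   value is a default and is never used. *)
Definition quantile01 (R : realType) (disp : measure_display)
    (Omega : measurableType disp) (P : probability Omega R) (X : {RV P >-> R})
    (p : R) : R :=
  inf [set v : R | (p%:E <= cdf X v)%E].

(* Only meaningful for p in [0, 1]. The limits at 0 and 1 exist when
   [essential_range X] is bounded. *)
Definition quantile (R : realType) (disp : measure_display)
    (Omega : measurableType disp) (P : probability Omega R) (X : {RV P >-> R})
    (p : R) : R :=
  if p == 0 then lim (quantile01 X x @[x --> (0 : R)^'+])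
  else if p == 1 then lim (quantile01 X x @[x --> (1 : R)^'-])
  else quantile01 X p.

(* Main.v *)
(* Let S be the essential range, an interval contained in [-N, N]. Cut the line
   into a grid of step h. Every grid cell inside S has positive probability, so
   testing the convergence against the finitely many trapezoids attached to the
   grid gives, for n large, errors smaller than each of these probabilities. If
   alpha_j and Q(u) were more than 4h apart, with u in [j/d, (j+1)/d], a full
   grid cell would separate them; since the ranks of alpha_j bracket u, the
   average of a suitable trapezoid would then differ from its integral by at
   least the probability of this cell. Both Q(u) and alpha_j lie in S, which is
   connected, so the cell is in S and this is a contradiction. The values of Q
   at 0 and 1 are reached by passing to the limit in u. *)
Require Import Defs.
From HB Require Import structures.
From mathcomp Require Import all_boot all_order all_algebra.
From mathcomp Require Import all_classical all_reals all_analysis.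
From mathcomp Require Import measurable_realfun ring lra.
Import Order.TTheory GRing.Theory Num.Theory.
Import numFieldNormedType.Exports.

Set Implicit Arguments.
Unset Strict Implicit.
Unset Printing Implicit Defensive.

Local Open Scope classical_set_scope.
Local Open Scope ring_scope.

(** * Trapezoidal test functions *)

(** A continuous, compactly supported substitute for the indicator of []-oo, v]]. For [- N <= v] and
    [0 < h] it rises from 0 to 1 on [[- N - 1, - N]], where no mass will lie, and falls back to 0 on
    [[v, v + h]]. *)
Definition trapezoid (R : realType) (N v h x : R) : R :=
  Num.max 0 (Num.min 1 (Num.min (N + 1 + x) ((v + h - x) / h))).

Lemma trapezoid_ge0 (R : realType) (N v h x : R) : 0 <= trapezoid N v h x.
Proof. by rewrite le_max lexx. Qed.

Lemma trapezoid_le1 (R : realType) (N v h x : R) : trapezoid N v h x <= 1.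
Proof. by rewrite ge_max ler01 ge_min lexx. Qed.

Lemma trapezoid_eq1 (R : realType) (N v h x : R) :
  0 < h -> - N <= x <= v -> trapezoid N v h x = 1.
Proof.
move=> h0 /andP[Nx xv]; apply/le_anti; rewrite trapezoid_le1/=.
rewrite le_max !le_min lexx ler_pdivlMr//; apply/orP; right.
by apply/andP; split => //; apply/andP; split; lra.
Qed.

Lemma trapezoid_eq0r (R : realType) (N v h x : R) :
  0 < h -> v + h <= x -> trapezoid N v h x = 0.
Proof.
move=> h0 vx; apply/le_anti; rewrite trapezoid_ge0 andbT.
by rewrite ge_max lexx !ge_min ler_pdivrMr// mul0r subr_le0 vx !orbT.
Qed.

Lemma trapezoid_eq0l (R : realType) (N v h x : R) :
  x <= - N - 1 -> trapezoid N v h x = 0.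
Proof.
move=> xN; apply/le_anti; rewrite trapezoid_ge0 andbT ge_max lexx !ge_min.
by apply/orP; right; apply/orP; left; lra.
Qed.

Lemma continuous_trapezoid (R : realType) (N v h : R) :
  continuous (trapezoid N v h).
Proof.
move=> x.
have c1 : {for x, continuous (fun x : R => N + 1 + x : R^o)}.
  by apply: cvgD; [exact: cvg_cst|exact: cvg_id].
have c2 : {for x, continuous (fun x : R => (v + h - x) / h : R^o)}.
  by apply: cvgMl; apply: cvgB; [exact: cvg_cst|exact: cvg_id].
have cC (c : R) : {for x, continuous (fun=> c : R^o)} by exact: cvg_cst.
exact: (continuous_max (cC 0) (continuous_min (cC 1) (continuous_min c1 c2))).
Qed.

Lemma compactly_supported_trapezoid (R : realType) (N v h : R) :
  0 < h -> compactly_supported (trapezoid N v h).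
Proof.
move=> h0; apply: (subclosed_compact _ (@segment_compact R (- N - 1) (v + h))).
  exact: closed_closure.
rewrite closureE; apply: smallest_sub; first exact: itv_closed.
move=> x /= x0; rewrite in_itv/=; apply/andP; split; rewrite leNgt.
  by apply: contraNN x0 => /ltW/trapezoid_eq0l ->.
by apply: contraNN x0 => /ltW/trapezoid_eq0r ->.
Qed.

(** * Expectations of test functions against probabilities *)

Lemma integrable_comp_RV (R : realType) (disp : measure_display)
    (Omega : measurableType disp) (P : probability Omega R) (X : {RV P >-> R})
    (phi : R -> R) :
  continuous phi -> (forall x, 0 <= phi x <= 1) ->
  P.-integrable setT (EFin \o (phi \o X)).
Proof.
move=> cphi phi01; apply: measurable_bounded_integrable => //.
- by rewrite -ge0_fin_numE// fin_num_measure.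
- by apply: measurableT_comp => //; exact: continuous_measurable_fun.
- exists 1; split => // y y1 w _ /=.
  have /andP[p0 p1] := phi01 (X w).
  by rewrite ger0_norm// (le_trans p1)// ltW.
Qed.

Lemma integrable_indic_RV (R : realType) (disp : measure_display)
    (Omega : measurableType disp) (P : probability Omega R) (X : {RV P >-> R})
    (A : set R) :
  measurable A -> P.-integrable setT (EFin \o \1_(X @^-1` A)).
Proof.
move=> mA; have mXA : measurable (X @^-1` A) by exact: measurable_funPTI.
apply: measurable_bounded_integrable => //.
- by rewrite -ge0_fin_numE// fin_num_measure.
- exists 1; split => // y y1 w _ /=; rewrite indicE.
  by case: (_ \in _); rewrite ?normr1 ?normr0 ltW// (lt_trans ltr01).
Qed.

Lemma Rintegral_indic_RV (R : realType) (disp : measure_display)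
    (Omega : measurableType disp) (P : probability Omega R) (X : {RV P >-> R})
    (A : set R) :
  measurable A -> \int[P]_w \1_(X @^-1` A) w = fine (distribution P X A).
Proof.
move=> mA; have mXA : measurable (X @^-1` A) by exact: measurable_funPTI.
by rewrite /Rintegral integral_indic// setIT.
Qed.

Lemma le_distribution_Rintegral (R : realType) (disp : measure_display)
    (Omega : measurableType disp) (P : probability Omega R) (X : {RV P >-> R})
    (phi : R -> R) (A : set R) :
  measurable A -> continuous phi -> (forall x, 0 <= phi x <= 1) ->
  (forall x, A x -> 1 <= phi x) ->
  fine (distribution P X A) <= \int[P]_w phi (X w).
Proof.
move=> mA cphi phi01 phi1; rewrite -Rintegral_indic_RV//.
apply: le_Rintegral => //; first exact: integrable_indic_RV.
  exact: integrable_comp_RV.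
move=> w _; rewrite indicE; have [/set_mem/= wA|_] := boolP (_ \in _).
  exact: phi1.
by have /andP[] := phi01 (X w).
Qed.

Lemma ge_distribution_Rintegral (R : realType) (disp : measure_display)
    (Omega : measurableType disp) (P : probability Omega R) (X : {RV P >-> R})
    (phi : R -> R) (A : set R) :
  measurable A -> continuous phi -> (forall x, 0 <= phi x <= 1) ->
  (forall x, ~ A x -> phi x <= 0) ->
  \int[P]_w phi (X w) <= fine (distribution P X A).
Proof.
move=> mA cphi phi01 phi1; rewrite -Rintegral_indic_RV//.
apply: le_Rintegral => //; first exact: integrable_comp_RV.
  exact: integrable_indic_RV.
move=> w _; rewrite indicE; have [_|/negP wA] := boolP (_ \in _).
  by have /andP[] := phi01 (X w).
by apply: phi1 => XA; apply: wA; rewrite inE.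
Qed.

Lemma fine_distributionK (R : realType) (disp : measure_display)
    (Omega : measurableType disp) (P : probability Omega R) (X : {RV P >-> R})
    (A : set R) :
  measurable A -> (fine (distribution P X A))%:E = distribution P X A.
Proof. by move=> mA; rewrite fineK// fin_num_measure. Qed.

(* The trapezoid equal to 1 on [-M, M] has average 1 at every stage, hence
   integral 1. *)
Lemma distribution_bounded (R : realType) (disp : measure_display)
    (Omega : measurableType disp) (P : probability Omega R) (X : {RV P >-> R})
    (d : nat -> nat) (alpha : forall n, 'I_(d n) -> R) (M : R) :
  (forall n, (0 < d n)%N) -> asymptotically_distributed X alpha ->
  (forall n j, - M <= alpha n j <= M) ->
  distribution P X `[- (M + 1), M + 1] = 1%E.
Proof.
move=> d0 alphaX alphaM.
pose psi : R -> R := trapezoid M M 1.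
have cpsi : continuous psi := @continuous_trapezoid R M M 1.
have psi01 x : 0 <= psi x <= 1 by rewrite trapezoid_ge0 trapezoid_le1.
have := alphaX psi cpsi (@compactly_supported_trapezoid R M M 1 ltr01).
under eq_cvg => n.
  rewrite (eq_bigr (fun=> 1)); last by move=> j _; rewrite /psi trapezoid_eq1.
  rewrite sumr_const card_ord mulVf; last by rewrite pnatr_eq0 -lt0n.
  over.
move=> /(cvg_unique _ (cvg_cst (1 : R))) int1.
apply/le_anti; rewrite probability_le1//= -fine_distributionK// lee_fin.
rewrite [leLHS]int1//; apply: ge_distribution_Rintegral => // x /=.
rewrite in_itv/= => /negP; rewrite negb_and -!ltNge => /orP[xM|xM].
  by rewrite /psi trapezoid_eq0l//; lra.
by rewrite /psi trapezoid_eq0r//; lra.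
Qed.

Lemma distribution_setC_eq0 (R : realType) (disp : measure_display)
    (Omega : measurableType disp) (P : probability Omega R) (X : {RV P >-> R})
    (A : set R) :
  measurable A -> distribution P X A = 1%E -> distribution P X (~` A) = 0%E.
Proof.
move=> mA PA; rewrite (probability_setC (distribution P X))//.
by rewrite [X in (1 - X)%E]PA subee.
Qed.

(** * Distribution function and quantiles of a law carried by [[- N, N]] *)

Lemma cdf_eq0 (R : realType) (disp : measure_display)
    (Omega : measurableType disp) (P : probability Omega R) (X : {RV P >-> R})
    (N v : R) :
  distribution P X `[- N, N] = 1%E -> v < - N -> cdf X v = 0%E.
Proof.
move=> PN vN; apply/le_anti; rewrite cdf_ge0 andbT.
have -> : 0%E = distribution P X (~` `[- N, N]).
  by rewrite distribution_setC_eq0.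
apply: le_measure; rewrite ?inE//; first exact: measurableC.
move=> x /=; rewrite !in_itv/= => xv /andP[Nx _].
by have := le_lt_trans (le_trans Nx xv) vN; rewrite ltxx.
Qed.

Lemma cdf_eq1 (R : realType) (disp : measure_display)
    (Omega : measurableType disp) (P : probability Omega R) (X : {RV P >-> R})
    (N : R) :
  distribution P X `[- N, N] = 1%E -> cdf X N = 1%E.
Proof.
move=> PN; apply/le_anti; rewrite cdf_le1/= -[leLHS]PN.
by apply: le_measure; rewrite ?inE// => x /=; rewrite !in_itv/= => /andP[].
Qed.

(** Makes the infimum defining [quantile01] a genuine one: [N] is in the set, and [- N] bounds it
    below because the cdf vanishes left of [- N] while [u] is positive. *)
Lemma has_inf_cdf (R : realType) (disp : measure_display)
    (Omega : measurableType disp) (P : probability Omega R) (X : {RV P >-> R})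
    (N u : R) :
  distribution P X `[- N, N] = 1%E -> 0 < u < 1 ->
  has_inf [set v : R | (u%:E <= cdf X v)%E].
Proof.
move=> PN /andP[u0 u1]; split.
  by exists N; rewrite /= (cdf_eq1 PN) lee_fin ltW.
exists (- N) => v /= uv; rewrite leNgt; apply/negP => vN.
by move: uv; rewrite (cdf_eq0 PN vN) lee_fin leNgt u0.
Qed.

(** With a strict inequality, the infimum yields a point of the set below [v] and monotonicity
    concludes, without right-continuity of the cdf. *)
Lemma quantile01_lt (R : realType) (disp : measure_display)
    (Omega : measurableType disp) (P : probability Omega R) (X : {RV P >-> R})
    (N u v : R) :
  distribution P X `[- N, N] = 1%E -> 0 < u < 1 ->
  quantile01 X u < v -> (u%:E <= cdf X v)%E.
Proof.
move=> PN u01 uv.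
have [A0 _] := has_inf_cdf PN u01.
have [w uw wv] := inf_lt A0 uv.
by rewrite (le_trans uw)// cdf_nondecreasing// ltW.
Qed.

Lemma lt_quantile01 (R : realType) (disp : measure_display)
    (Omega : measurableType disp) (P : probability Omega R) (X : {RV P >-> R})
    (N u v : R) :
  distribution P X `[- N, N] = 1%E -> 0 < u < 1 ->
  v < quantile01 X u -> (cdf X v < u%:E)%E.
Proof.
move=> PN u01 vu; rewrite ltNge; apply/negP => uv.
have [_ lA] := has_inf_cdf PN u01.
by have := lt_le_trans vu (ge_inf lA uv); rewrite ltxx.
Qed.

Lemma quantile01_homo (R : realType) (disp : measure_display)
    (Omega : measurableType disp) (P : probability Omega R) (X : {RV P >-> R})
    (N : R) :
  distribution P X `[- N, N] = 1%E ->
  {in `]0, 1[ &, {homo quantile01 X : u v / u <= v}}.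
Proof.
move=> PN u v; rewrite !in_itv/= => u01 v01 uv.
have [_ lA] := has_inf_cdf PN u01; have [B0 _] := has_inf_cdf PN v01.
apply: lb_le_inf => // w /= vw; apply: ge_inf => //=.
by apply: le_trans vw; rewrite lee_fin.
Qed.

(** * Mass of open intervals and the essential range *)

Lemma cdfD_itv (R : realType) (disp : measure_display)
    (Omega : measurableType disp) (P : probability Omega R) (X : {RV P >-> R})
    (v w : R) :
  v < w -> (cdf X v + distribution P X `]v, w[ = distribution P X `]-oo, w[)%E.
Proof.
move=> vw; rewrite /cdf -measureU//; last first.
  apply/seteqP; split => // x [] /=; rewrite !in_itv/= => xv /andP[vx _].
  by have := le_lt_trans xv vx; rewrite ltxx.
congr (distribution P X _); apply/seteqP; split => x /=.
  by rewrite !in_itv/= => -[/le_lt_trans|/andP[]//]; apply.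
rewrite !in_itv/= => xw.
by have [xv|vx] := leP x v; [left|right; apply/andP].
Qed.

Lemma fine_cdfD_itv_le (R : realType) (disp : measure_display)
    (Omega : measurableType disp) (P : probability Omega R) (X : {RV P >-> R})
    (v w : R) :
  v < w -> fine (cdf X v) + fine (distribution P X `]v, w[) <= fine (cdf X w).
Proof.
move=> vw; rewrite -lee_fin EFinD !fine_distributionK// [leLHS]cdfD_itv//.
by apply: le_measure; rewrite ?inE// => x /=; rewrite !in_itv/=; exact: ltW.
Qed.

(** If []q - e, q + e[] were null, the cdf could not grow between [q - e], where it is below [u],
    and [q + e / 2], where it is at least [u]. Halving [e] keeps the second point inside the open
    interval. *)
Lemma essential_range_quantile01 (R : realType) (disp : measure_display)
    (Omega : measurableType disp) (P : probability Omega R) (X : {RV P >-> R})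
    (N u : R) :
  distribution P X `[- N, N] = 1%E -> 0 < u < 1 ->
  essential_range X (quantile01 X u).
Proof.
move=> PN u01 e e0; set q := quantile01 X u.
have le_cdf : (u%:E <= cdf X (q + e / 2))%E.
  by apply: quantile01_lt PN u01 _; rewrite ltrDl divr_gt0.
have lt_cdf : (cdf X (q - e) < u%:E)%E.
  by apply: lt_quantile01 PN u01 _; rewrite ltrBlDr ltrDl.
rewrite lt0e measure_ge0 andbT; apply/eqP => Pe0.
have : (cdf X (q + e / 2) <= cdf X (q - e))%E.
  have <- : distribution P X `]-oo, q + e[ = cdf X (q - e).
    rewrite -(@cdfD_itv _ _ _ _ X (q - e)); last by lra.
    by rewrite [X in (_ + X)%E]Pe0 adde0.
  apply: le_measure; rewrite ?inE// => x /=; rewrite !in_itv/=; lra.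
by move/(le_trans le_cdf); rewrite leNgt lt_cdf.
Qed.

(** The midpoint of []v, w[] lies between [a] and [b], hence in the essential range by
    connectedness; the interval is its neighbourhood of radius [(w - v) / 2]. *)
Lemma essential_range_itv_gt0 (R : realType) (disp : measure_display)
    (Omega : measurableType disp) (P : probability Omega R) (X : {RV P >-> R})
    (a b v w : R) :
  connected (essential_range X) -> essential_range X a -> essential_range X b ->
  a <= v -> w <= b -> v < w -> 0 < fine (distribution P X `]v, w[).
Proof.
move=> /connected_intervalP itvX Xa Xb av wb vw.
have Xm : essential_range X ((v + w) / 2) by apply: itvX Xa Xb _ _; lra.
rewrite -lte_fin fine_distributionK//.
have := Xm ((w - v) / 2); rewrite divr_gt0 ?subr_gt0// => /(_ isT).
have -> : (v + w) / 2 - (w - v) / 2 = v by field.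
by have -> : (v + w) / 2 + (w - v) / 2 = w by field.
Qed.

(** * Trapezoids against the cdf, and averages against ranks *)

Lemma cdf_le_trapezoid (R : realType) (disp : measure_display)
    (Omega : measurableType disp) (P : probability Omega R) (X : {RV P >-> R})
    (N v h : R) :
  distribution P X `[- N, N] = 1%E -> 0 < h ->
  fine (cdf X v) <= \int[P]_w trapezoid N v h (X w).
Proof.
move=> PN h0; apply: (@le_trans _ _ (fine (distribution P X `[- N, v]))).
  (* Cover []-oo, v]] by [[- N, v]] and the complement of [[- N, N]], which is null. *)
  rewrite -lee_fin !fine_distributionK//.
  have := @measureU2 _ _ _ (distribution P X) `[- N, v] (~` `[- N, N])
    (measurable_itv _) (measurableC (measurable_itv _)).
  rewrite [X in (_ + X)%E]distribution_setC_eq0// adde0; apply: le_trans.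
  apply: le_measure; rewrite ?inE//.
    by apply: measurableU => //; exact: measurableC.
  move=> x /=; rewrite !in_itv/= => xv.
  have [Nx|xN] := leP (- N) x; first by left.
  by right.
apply: (@le_distribution_Rintegral _ _ _ _ X (trapezoid N v h)) => //.
  exact: continuous_trapezoid.
  by move=> x; rewrite trapezoid_ge0 trapezoid_le1.
by move=> x /=; rewrite in_itv/= => xv; rewrite trapezoid_eq1.
Qed.

Lemma trapezoid_le_cdf (R : realType) (disp : measure_display)
    (Omega : measurableType disp) (P : probability Omega R) (X : {RV P >-> R})
    (N v h : R) :
  0 < h -> \int[P]_w trapezoid N v h (X w) <= fine (cdf X (v + h)).
Proof.
move=> h0; apply: (@ge_distribution_Rintegral _ _ _ _ X (trapezoid N v h)) => //.
- exact: continuous_trapezoid.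
- by move=> x; rewrite trapezoid_ge0 trapezoid_le1.
- move=> x /= /negP; rewrite in_itv/= -ltNge => /ltW vx.
  by rewrite trapezoid_eq0r.
Qed.

(** Only indices strictly below [j] contribute; numbered from 0, there are [j] of them, each
    contributing at most 1. *)
Lemma average_le_rank (R : realType) (d : nat) (a : 'I_d -> R) (phi : R -> R)
    (j : 'I_d) :
  (forall i j : 'I_d, (i <= j)%N -> a i <= a j) -> (forall x, phi x <= 1) ->
  (forall x, a j <= x -> phi x = 0) ->
  d%:R^-1 * (\sum_(i < d) phi (a i)) <= j%:R / d%:R.
Proof.
move=> a_le phi1 phi0; rewrite mulrC ler_wpM2r ?invr_ge0//.
rewrite (bigID (fun i : 'I_d => i < j)%N)/= [X in _ + X]big1 => [|i]; last first.
  by rewrite -leqNgt => /a_le/phi0.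
rewrite addr0 (le_trans (ler_sum _ (fun i _ => phi1 (a i))))//.
rewrite -(big_ord_widen d (fun=> 1 : R) (ltnW (ltn_ord j))).
by rewrite sumr_const card_ord.
Qed.

(** The [j.+1] indices up to and including [j] contribute 1 each, and the others are nonnegative. *)
Lemma average_ge_rank (R : realType) (d : nat) (a : 'I_d -> R) (phi : R -> R)
    (j : 'I_d) :
  (forall i j : 'I_d, (i <= j)%N -> a i <= a j) -> (forall x, 0 <= phi x) ->
  (forall i, a i <= a j -> phi (a i) = 1) ->
  j.+1%:R / d%:R <= d%:R^-1 * (\sum_(i < d) phi (a i)).
Proof.
move=> a_le phi0 phi1; rewrite [leRHS]mulrC ler_wpM2r ?invr_ge0//.
rewrite (bigID (fun i : 'I_d => i < j.+1)%N)/= ler_wpDr ?sumr_ge0//.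
rewrite (eq_bigr (fun=> 1)) => [|i]; last by rewrite ltnS => /a_le/phi1.
rewrite -(big_ord_widen d (fun=> 1 : R) (ltn_ord j)).
by rewrite sumr_const card_ord.
Qed.

(** * The uniform estimate for [u] in []0, 1[] *)

Lemma near_dist_quantile01_le (R : realType) (disp : measure_display)
    (Omega : measurableType disp) (P : probability Omega R) (X : {RV P >-> R})
    (d : nat -> nat) (alpha : forall n, 'I_(d n) -> R) (N h : R) :
  asymptotically_distributed X alpha ->
  connected (essential_range X) ->
  (forall x, essential_range X x -> - N <= x <= N) ->
  distribution P X `[- N, N] = 1%E ->
  (forall n j, essential_range X (alpha n j)) ->
  (forall n (i j : 'I_(d n)), (i <= j)%N -> alpha n i <= alpha n j) ->
  0 < h ->
  \forall n \near \oo, forall (j : 'I_(d n)) (u : R), 0 < u < 1 ->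
    j%:R / (d n)%:R <= u <= j.+1%:R / (d n)%:R ->
    `|alpha n j - quantile01 X u| <= 4 * h.
Proof.
move=> alphaX connX XN PN Xalpha alpha_le h0.
pose v (k : nat) : R := - N + k%:R * h.
have vS k : v k.+1 = v k + h by rewrite /v mulrSr mulrDl mul1r addrA.
have v_lt k : v k < v k.+1 by rewrite vS ltrDl.
(* Every grid point [v k <= N] has [k <= 2 * N / h], so [K] bounds all the indices in use. *)
pose K := (Num.truncn (2 * N / h)).+1.
have ltK k : v k <= N -> (k < K)%N.
  rewrite /v => vN; have kN : k%:R <= 2 * N / h by rewrite ler_pdivlMr//; lra.
  by rewrite ltnS truncn_ge_nat// (le_trans _ kN).
have grid x : - N <= x -> exists k, x < v k <= x + h.
  move=> Nx; have : 0 <= (x + N) / h by apply: divr_ge0; [lra|exact: ltW].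
  move=> /truncn_itv/andP[]; set k := Num.truncn _.
  rewrite ler_pdivlMr// ltr_pdivrMr// => kx xk; exists k.+1.
  by move: xk; rewrite /v -natr1; lra.
pose phi k : R -> R := trapezoid N (v k) h.
pose avg k n := (d n)%:R^-1 * \sum_(i < d n) phi k (alpha n i).
pose I k := \int[P]_w phi k (X w).
pose m k := fine (distribution P X `]v k, v k.+1[).
(* Trapezoid and cell have separate indices because the two cases below pair them differently. Only
   cells of positive mass can serve as a tolerance, and finitely many pairs share one threshold on
   [n]. *)
have : \forall n \near \oo, forall k l : 'I_K, 0 < m l -> `|I k - avg k n| < m l.
  apply: filter_forall => k; apply: filter_forall => l.
  have [ml|ml] := ltP 0 (m l); last exact: nearW.
  have avgI : avg k n @[n --> \oo] --> I k.
    apply: (alphaX (phi k)); last exact: compactly_supported_trapezoid.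
    exact: continuous_trapezoid.
  by near=> n => _; near: n; exact: cvgr_dist_lt avgI _ ml.
apply: filterS => n avgI j u u01 /andP[ju uj].
have Xq := essential_range_quantile01 PN u01.
have Xa := Xalpha n j.
have cdf_fin x : cdf X x = (fine (cdf X x))%:E by rewrite fine_distributionK.
set q := quantile01 X u in Xq *; set a := alpha n j in Xa *.
have /andP[Nq qN] := XN _ Xq; have /andP[Na aN] := XN _ Xa.
rewrite ler_norml; apply/andP; split; rewrite leNgt; apply/negP => far.
(* Case [a + 4 * h < q], with [a < v k]. Trapezoid [k] is 1 at all entries up to [a], so its average
   is at least [j.+1 / d n >= u]. Its integral is at most the cdf at [v k.+1], hence below
   [u - m k.+1], since the cdf at [v k.+2] is still below [u]. *)
- have [k /andP[ak ka]] := grid _ Na.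
  have aq : v k.+2 <= q by rewrite !vS; lra.
  have k1K : (k.+1 < K)%N.
    by apply: ltK; rewrite (le_trans _ qN)// (le_trans _ aq)// ltW.
  have kK : (k < K)%N by exact: ltn_trans k1K.
  have m_gt0 : 0 < m k.+1.
    by apply: essential_range_itv_gt0 connX Xa Xq _ aq (v_lt _); rewrite vS; lra.
  have := avgI (Ordinal kK) (Ordinal k1K) m_gt0; rewrite /=.
  have avg_ge : j.+1%:R / (d n)%:R <= avg k n.
    apply: (@average_ge_rank _ _ _ (phi k) _ (alpha_le n)).
      by move=> x; exact: trapezoid_ge0.
    move=> i ia; apply: trapezoid_eq1 => //.
    have /andP[-> _] /= := XN _ (Xalpha n i).
    by rewrite (le_trans ia)// ltW.
  have I_le : I k <= fine (cdf X (v k.+1)) by rewrite vS; exact: trapezoid_le_cdf.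
  have cdf_lt : fine (cdf X (v k.+2)) < u.
    by rewrite -lte_fin -cdf_fin; apply: lt_quantile01 PN u01 _; rewrite !vS; lra.
  have := fine_cdfD_itv_le X (v_lt k.+1); rewrite -/(m k.+1) ltr_norml; lra.
(* Case [q + 4 * h < a], with [q < v k]. Trapezoid [k.+1] vanishes from [v k.+2 <= a] on, so its
   average is at most [j / d n <= u]. Its integral is at least the cdf at [v k.+1], hence at least
   [u + m k]. *)
- have [k /andP[qk kq]] := grid _ Nq.
  have ka : v k.+2 <= a by rewrite !vS; lra.
  have k1K : (k.+1 < K)%N.
    by apply: ltK; rewrite (le_trans _ aN)// (le_trans _ ka)// ltW.
  have kK : (k < K)%N by exact: ltn_trans k1K.
  have m_gt0 : 0 < m k.
    apply: essential_range_itv_gt0 connX Xq Xa (ltW qk) _ (v_lt _).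
    by rewrite vS; lra.
  have := avgI (Ordinal k1K) (Ordinal kK) m_gt0; rewrite /=.
  have avg_le : avg k.+1 n <= j%:R / (d n)%:R.
    apply: (@average_le_rank _ _ _ (phi k.+1) _ (alpha_le n)).
      by move=> x; exact: trapezoid_le1.
    by move=> x ax; apply: trapezoid_eq0r => //; rewrite -vS (le_trans ka).
  have I_ge : fine (cdf X (v k.+1)) <= I k.+1 by exact: cdf_le_trapezoid.
  have cdf_ge : u <= fine (cdf X (v k)).
    by rewrite -lee_fin -cdf_fin; exact: quantile01_lt PN u01 _.
  have := fine_cdfD_itv_le X (v_lt k); rewrite -/(m k) ltr_norml; lra.
Unshelve. all: by end_near.
Qed.

(** * Extension to the endpoints 0 and 1 *)

(** Shows that the [lim] in [quantile] is not a default value: [quantile01] is monotone on []0, 1[]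
    and its values, being in the essential range, are bounded below by [- N]. *)
Lemma cvg_quantile01_at0 (R : realType) (disp : measure_display)
    (Omega : measurableType disp) (P : probability Omega R) (X : {RV P >-> R})
    (N : R) :
  distribution P X `[- N, N] = 1%E ->
  (forall x, essential_range X x -> - N <= x <= N) ->
  quantile01 X x @[x --> (0 : R)^'+] --> quantile X 0.
Proof.
move=> PN XN; rewrite /quantile eqxx.
apply: nondecreasing_at_right_is_cvgr; near=> b.
  have b1 : b < 1 by near: b; exact: nbhs_right_lt.
  move=> u v; rewrite !in_itv/= => /andP[u0 ub] /andP[v0 vb].
  by apply: quantile01_homo PN _ _ _ _; rewrite in_itv/= ?u0 ?v0/=; lra.
have b1 : b < 1 by near: b; exact: nbhs_right_lt.
exists (- N) => _ [u /= + <-]; rewrite in_itv/= => /andP[u0 ub].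
have u01 : 0 < u < 1 by lra.
by have /XN/andP[] := essential_range_quantile01 PN u01.
Unshelve. all: by end_near.
Qed.

Lemma cvg_quantile01_at1 (R : realType) (disp : measure_display)
    (Omega : measurableType disp) (P : probability Omega R) (X : {RV P >-> R})
    (N : R) :
  distribution P X `[- N, N] = 1%E ->
  (forall x, essential_range X x -> - N <= x <= N) ->
  quantile01 X x @[x --> (1 : R)^'-] --> quantile X 1.
Proof.
move=> PN XN; rewrite /quantile oner_eq0 eqxx.
apply: nondecreasing_at_left_is_cvgr; near=> b.
  have b0 : 0 < b by near: b; exact: nbhs_left_gt.
  move=> u v; rewrite !in_itv/= => /andP[bu u1] /andP[bv v1].
  by apply: quantile01_homo PN _ _ _ _; rewrite in_itv/= ?u1 ?v1/=; lra.
have b0 : 0 < b by near: b; exact: nbhs_left_gt.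
exists N => _ [u /= + <-]; rewrite in_itv/= => /andP[bu u1].
have u01 : 0 < u < 1 by lra.
by have /XN/andP[] := essential_range_quantile01 PN u01.
Unshelve. all: by end_near.
Qed.

(** A non-strict bound survives one-sided limits. As [a < b], an endpoint 0 or 1 of [[a, b]] is
    approached by points of []0, 1[] still in [[a, b]]. *)
Lemma dist_quantile_le (R : realType) (disp : measure_display)
    (Omega : measurableType disp) (P : probability Omega R) (X : {RV P >-> R})
    (N a b c e : R) :
  distribution P X `[- N, N] = 1%E ->
  (forall x, essential_range X x -> - N <= x <= N) ->
  0 <= a -> a < b -> b <= 1 ->
  (forall u, 0 < u < 1 -> a <= u <= b -> `|c - quantile01 X u| <= e) ->
  forall u, a <= u <= b -> `|c - quantile X u| <= e.
Proof.
move=> PN XN a0 ab b1 close u /andP[au ub].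
have dist_cvg (F : set_system R) l : Filter F ->
    quantile01 X x @[x --> F] --> l ->
    `|c - quantile01 X x| @[x --> F] --> `|c - l|.
  by move=> FF Ql; apply: cvg_norm; apply: cvgB => //; exact: cvg_cst.
have [u0|u0] := eqVneq u 0.
  rewrite u0; apply: (cvgr_to_le (dist_cvg _ _ _ (cvg_quantile01_at0 PN XN))).
  near=> x.
  have x0 : 0 < x by [].
  have xb : x < b by near: x; apply: nbhs_right_lt; lra.
  by apply: close; lra.
have [u1|u1] := eqVneq u 1.
  rewrite u1; apply: (cvgr_to_le (dist_cvg _ _ _ (cvg_quantile01_at1 PN XN))).
  near=> x.
  have x0 : x < 1 by [].
  have xa : a < x by near: x; apply: nbhs_left_gt; lra.
  by apply: close; lra.
rewrite /quantile (negbTE u0) (negbTE u1); apply: close; last exact/andP.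
by rewrite lt_neqAle eq_sym u0 (le_trans a0)//= lt_neqAle u1 (le_trans ub).
Unshelve. all: by end_near.
Qed.

(** * The uniform estimate on [[0, 1]] and the two limits *)

Lemma near_dist_quantile_le (R : realType) (disp : measure_display)
    (Omega : measurableType disp) (P : probability Omega R) (X : {RV P >-> R})
    (d : nat -> nat) (alpha : forall n, 'I_(d n) -> R) (e : R) :
  (forall n, (0 < d n)%N) ->
  asymptotically_distributed X alpha ->
  connected (essential_range X) -> bounded_set (essential_range X) ->
  (forall n j, essential_range X (alpha n j)) ->
  (forall n (i j : 'I_(d n)), (i <= j)%N -> alpha n i <= alpha n j) ->
  0 < e ->
  \forall n \near \oo, forall (j : 'I_(d n)) (u : R),
    j%:R / (d n)%:R <= u <= j.+1%:R / (d n)%:R ->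
    `|alpha n j - quantile X u| <= e.
Proof.
move=> d0 alphaX connX [M [_ XM]] Xalpha alpha_le e0.
(* [bounded_set] only provides bounds strictly larger than [M], hence the [+ 1];
   [distribution_bounded] costs another 1, so [N] becomes [|M| + 1 + 1]. *)
have {}XM x : essential_range X x -> - (`|M| + 1) <= x <= `|M| + 1.
  move=> Xx; rewrite -ler_norml; apply: XM => //.
  by rewrite (le_lt_trans (ler_norm M))// ltrDl.
have PN := distribution_bounded d0 alphaX (fun n j => XM _ (Xalpha n j)).
have XN x : essential_range X x -> - (`|M| + 1 + 1) <= x <= `|M| + 1 + 1.
  by move=> /XM; lra.
have e4 : 0 < e / 4 by rewrite divr_gt0.
apply: filterS (near_dist_quantile01_le alphaX connX XN PN Xalpha alpha_le e4).
move=> n close j; have dn0 : 0 < (d n)%:R :> R by rewrite ltr0n.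
apply: (dist_quantile_le PN XN).
- by rewrite divr_ge0.
- by rewrite ltr_pM2r ?invr_gt0// ltr_nat.
- by rewrite ler_pdivrMr// mul1r ler_nat.
- move=> u u01 ju; rewrite (le_trans (close j u u01 ju))//; lra.
Qed.

(** Taking [e = 1] makes [f] eventually finite, which reduces the claim to real convergence of
    [fine]. *)
Lemma ge0_cvge0 (R : realType) (f : nat -> \bar R) :
  (forall n, (0 <= f n)%E) ->
  (forall e, 0 < e -> \forall n \near \oo, (f n <= e%:E)%E) ->
  f n @[n --> \oo] --> 0%E.
Proof.
move=> f0 fe; apply/fine_cvgP; split.
  apply: filterS (fe 1 ltr01) => n fn1.
  by rewrite ge0_fin_numE// (le_lt_trans fn1)// ltry.
apply/cvgr0Pnorm_le => e e0; apply: filterS (fe e e0) => n fne.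
have fn : f n \is a fin_num by rewrite ge0_fin_numE// (le_lt_trans fne)// ltry.
by rewrite /= ger0_norm ?fine_ge0// -lee_fin fineK.
Qed.

(* The index j : 'I_(d n) stands for the paper's index j + 1. The supremum is
   taken in the extended reals, so that it is a genuine one. *)
Theorem theorem1p2 (R : realType) (disp : measure_display)
    (Omega : measurableType disp) (P : probability Omega R) (X : {RV P >-> R})
    (d : nat -> nat) (alpha : forall n : nat, 'I_(d n) -> R)
    (d_gt0 : forall n : nat, (0 < d n)%N)
    (d_oo : d n @[n --> \oo] --> \oo)
    (alphaX : asymptotically_distributed X alpha)
    (connX : connected (essential_range X))
    (bndX : bounded_set (essential_range X))
    (alpha_in : forall (n : nat) (j : 'I_(d n)), essential_range X (alpha n j))
    (alpha_le : forall (n : nat) (i j : 'I_(d n)),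
      (i <= j)%N -> alpha n i <= alpha n j) :
  ((\big[maxe/-oo%E]_(j < d n)
      ereal_sup [set `|alpha n j - quantile X u|%:E |
                   u in `[j%:R / (d n)%:R, j.+1%:R / (d n)%:R] ])
     @[n --> \oo] --> 0%E)
  /\
  ((\big[Num.max/0]_(j < d n) `|alpha n j - quantile X (j.+1%:R / (d n)%:R)|)
     @[n --> \oo] --> (0 : R)).
Proof.
have near_le (e : R) :=
  @near_dist_quantile_le _ _ _ _ _ _ _ e
    d_gt0 alphaX connX bndX alpha_in alpha_le.
have ends n (j : 'I_(d n)) : j%:R / (d n)%:R <= j.+1%:R / (d n)%:R :> R.
  by rewrite ler_pM2r ?invr_gt0 ?ltr0n// ler_nat.
split.
  apply: ge0_cvge0 => [n|e e0].
    (* Both the maximum and the supremum would be [-oo] if empty, so nonnegativity is read off an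
       actual term: index 0 at [u = 0]. *)
    apply: le_trans (le_bigmax _ _ (Ordinal (d_gt0 n))).
    apply: le_ereal_sup_tmp.
    exists `|alpha n (Ordinal (d_gt0 n)) - quantile X 0|%:E; last by rewrite lee_fin.
    by exists 0 => //=; rewrite in_itv/= mul0r lexx divr_ge0.
  apply: filterS (near_le e e0) => n close; apply: bigmax_le => [|j _].
    exact: leNye.
  by apply: ge_ereal_sup => _ [u /= + <-]; rewrite in_itv/= lee_fin; exact: close.
(* The second limit takes [u] to be the right end of each segment; the base value 0 of the maximum
   is harmless for absolute values. *)
apply/cvgr0Pnorm_le => e e0; apply: filterS (near_le e e0) => n close.
rewrite ger0_norm ?bigmax_ge_id//; apply: bigmax_le => [|j _]; first exact: ltW.
by apply: close; rewrite lexx andbT.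
Qed.
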